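(* Let $0\le x<x'$ and $y\in[b,+\infty)$. Then the value function $v$ satisfies $$v(x',y)-v(x,y)\ge x'-x.$$
   Context: Let $(\Omega,\mathcal F,\mathbb P)$ be a probability space with a complete right-continuous filtration $\mathbb F$. Fix constants $c,a,b,\eta,\rho>0$ and $\delta>1$. The claim sizes $(Y_k)_{k\ge1}$ are i.i.d. positive random variables with density $f$ and distribution function $F$, independent of the claim-counting process. For $y\ge b$, the claim-counting process $N=(N_t)_{t\ge0}$ is a Hawkes process with intensity $\lambda=(\lambda_t)_{t\ge 0}$ satisfying $d\lambda_t=a(b-\lambda_t)\,dt+\eta\,dN_t$, $\lambda_0=y$. The uncontrolled surplus is $R^x_t=x+ct-\sum_{k=1}^{N_t}Y_k$. A strategy is a pair $\alpha=(Z,K)$ (cumulative dividends, cumulative capital injections), and the controlled surplus is $X_t=R^x_t-Z_t+K_t$, with $X_{0^-}=x$. For $(x,y)\in\mathbb R\times[b,+\infty)$, the set $\mathcal A(x,y)$ of admissible strategies (for initial state $(X_0,\lambda_0)=(x,y)$) consists of those $\alpha$ such that: $Z$ is right-continuous with left limits, $\mathbb F$-adapted, non-decreasing, $Z_{0^-}=0$ and $Z_t-Z_{t^-}\le (X_{t^-}+R^0_t-R^0_{t^-})^+$ for all $t$; and $K$ is left-continuous with right limits, $\mathbb F$-adapted, non-decreasing, $K_{0^-}=0$. The ruin time is $T^\alpha=\inf\{t\ge0: X_{t^+}<0\}$. The reward and the value function are $$J_\alpha(x,y)=\mathbb E\Big[\int_0^{T^\alpha}e^{-\rho s}\,dZ_s-\delta\int_0^{T^\alpha}e^{-\rho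 s}\,dK_s\Big],\qquad v(x,y)=\sup_{\alpha\in\mathcal A(x,y)}J_\alpha(x,y),$$ where the integrals include lump-sum payments and injections made at time $0$. *)

(* Defs.v *)
From HB Require Import structures.
From mathcomp Require Import all_boot all_order all_algebra.
From mathcomp Require Import all_classical all_reals all_analysis.

Set Implicit Arguments.
Unset Strict Implicit.
Unset Printing Implicit Defensive.

Import Order.TTheory GRing.Theory Num.Theory.
Import numFieldNormedType.Exports.

Local Open Scope classical_set_scope.
Local Open Scope ring_scope.

(* Processes are functions of the outcome and of the time: [X w t].  Time is a
   real number, and every process that may jump at time 0 is extended to
   negative times by its value at 0^-, so that left limits at 0, and the atom
   at 0 of a Stieltjes measure, have their intended meaning. *)

Section Stieltjes.
Context {R : realType}.

Record monotone_path := MonotonePath {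
  path_fun :> R -> R;
  path_nondecreasing : {homo path_fun : s t / s <= t} }.

Implicit Type A : monotone_path.

Definition right_lim A (t : R) : R := lim (A s @[s --> t^'+]).

Lemma right_lim_cvg A t : A s @[s --> t^'+] --> right_lim A t.
Proof.
apply: (nondecreasing_at_right_is_cvgr (f := A)).
  by near=> e => u v _ _; exact: path_nondecreasing.
near=> e; exists (A t) => _ [u /= + <-].
by rewrite in_itv/= => /andP[/ltW/path_nondecreasing].
Unshelve. all: by end_near. Qed.

Lemma right_lim_ge A t : A t <= right_lim A t.
Proof.
apply: limr_ge; first exact: right_lim_cvg.
near=> u; apply: path_nondecreasing; exact/ltW.
Unshelve. all: by end_near. Qed.

Lemma right_lim_le A s t : s < t -> right_lim A s <= A t.
Proof.
move=> st; apply: limr_le; first exact: right_lim_cvg.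
near=> u; apply: path_nondecreasing; apply/ltW.
by near: u; exact: nbhs_right_lt.
Unshelve. all: by end_near. Qed.

Lemma right_lim_nondecreasing A : {homo right_lim A : s t / s <= t}.
Proof.
move=> s t; rewrite le_eqVlt => /predU1P[->//|st].
exact: le_trans (right_lim_le A st) (right_lim_ge A t).
Qed.

Lemma right_lim_right_continuous A : right_continuous (right_lim A).
Proof.
move=> t; apply/cvgrPdist_lt => e e0.
have /cvgrPdist_lt/(_ _ e0) := @right_lim_cvg A t.
rewrite near_withinE => -[r /= r0 H].
near=> u.
have tu : t < u by [].
have ur : u < t + r by near: u; apply: nbhs_right_lt; rewrite ltrDl.
set m := (u + (t + r)) / 2.
have um : u < m by rewrite /m midf_lt.
have mr : m < t + r by rewrite /m midf_lt.
have tm : t < m by exact: lt_trans um.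
have := H m; rewrite /ball/= distrC gtr0_norm ?subr_gt0// ltrBlDl => /(_ mr tm).
rewrite !ler0_norm ?subr_le0 ?right_lim_le// ?right_lim_nondecreasing ?(ltW tu)//.
by rewrite !opprB; apply: le_lt_trans; rewrite lerB// right_lim_le.
Unshelve. all: by end_near. Qed.

HB.instance Definition _ A := @isCumulative.Build R _ R (right_lim A)
  (@right_lim_nondecreasing A) (@right_lim_right_continuous A).

(* The measure [dA]: its atom at [s] has mass [A_{s^+} - A_{s^-}], whichever
   one-sided continuity [A] has. *)
Definition stieltjes A := lebesgue_stieltjes_measure (right_lim A).

End Stieltjes.
Arguments monotone_path : clear implicits.

Section Probability.
Context {R : realType} {d : measure_display} {Omega : measurableType d}.
Variable P : probability Omega R.

(* The last clause is completeness; with the first one, it forces the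
   sigma-algebra of [Omega] to be complete as well. *)
Definition usual_filtration (Ft : R -> set (set Omega)) : Prop :=
  [/\ forall t, 0 <= t ->
        sigma_algebra [set: Omega] (Ft t) /\ Ft t `<=` measurable,
      forall s t, 0 <= s -> s <= t -> Ft s `<=` Ft t,
      forall t, 0 <= t -> Ft t = \bigcap_(s in `]t, +oo[) Ft s
    & forall A, P.-negligible A -> Ft 0 A].

Definition adapted (Ft : R -> set (set Omega)) {d'} {V : measurableType d'}
    (X : Omega -> R -> V) : Prop :=
  forall t, 0 <= t -> forall B, measurable B -> Ft t [set w | B (X w t)].

Definition generated_sigma_algebra {I : Type} {d'} {V : measurableType d'}
    (X : I -> Omega -> V) : set (set Omega) :=
  <<s \bigcup_i preimage_set_system [set: Omega] (X i) measurable >>.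

Definition independent_sigma_algebras (G H : set (set Omega)) : Prop :=
  forall A B, G A -> H B -> P (A `&` B) = (P A * P B)%E.

Definition mutually_independent (Y : nat -> {RV P >-> R}) : Prop :=
  forall (s : seq nat) (B : nat -> set R), uniq s ->
    (forall k, measurable (B k)) ->
    P (\bigcap_(k in [set` s]) Y k @^-1` B k) =
    (\prod_(k <- s) P (Y k @^-1` B k))%E.

Definition has_density (Y : {RV P >-> R}) (f : R -> R) : Prop :=
  [/\ measurable_fun setT f, forall r, 0 <= f r
    & forall B, measurable B ->
        distribution P Y B = (\int[lebesgue_measure]_(r in B) (f r)%:E)%E].

Definition counting_process (N : Omega -> R -> nat) : Prop :=
  forall w,
  [/\ forall t, t <= 0 -> N w t = 0%N,
      forall s t, s <= t -> (N w s <= N w t)%N,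
      forall t, \forall s \near t^'+, N w s = N w t
    & forall t, \forall s \near t^'-, (N w t <= (N w s).+1)%N].

(* [E[N_t - N_s | F_s] = E[int_s^t lambda_u du | F_s]], tested against the
   events of [F_s]. *)
Definition has_intensity (Ft : R -> set (set Omega)) (N : Omega -> R -> nat)
    (lambda : Omega -> R -> R) : Prop :=
  forall s t A, 0 <= s -> s <= t -> Ft s A ->
    (\int[P]_(w in A) ((N w t)%:R - (N w s)%:R)%:E =
     \int[P]_(w in A) \int[lebesgue_measure]_(u in `[s, t]) (lambda w u)%:E)%E.

Definition hawkes_process (Ft : R -> set (set Omega)) (a b eta y : R)
    (N : Omega -> R -> nat) (lambda : Omega -> R -> R) : Prop :=
  [/\ counting_process N, adapted Ft N, adapted Ft lambda,
      has_intensity Ft N lambda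
    & forall w t, 0 <= t ->
        lebesgue_measure.-integrable `[0, t] (EFin \o lambda w) /\
        lambda w t = y + (\int[lebesgue_measure]_(s in `[0, t])
                              (a * (b - lambda w s))) + eta * (N w t)%:R].

End Probability.

Section Control.
Context {R : realType} {d : measure_display} {Omega : measurableType d}.
Variables (P : probability Omega R) (Ft : R -> set (set Omega)).
Variables (c rho delta : R) (N : Omega -> R -> nat) (Y : nat -> {RV P >-> R}).

(* Claim sizes are indexed from 0: the sum has the first [N w t] of them. *)
Definition surplus (x : R) (w : Omega) (t : R) : R :=
  x + c * Num.max 0 t - \sum_(k < N w t) Y k w.

Record strategy := Strategy {
  dividends : Omega -> monotone_path R;
  injections : Omega -> monotone_path R }.

Definition controlled_surplus (x : R) (alpha : strategy) w t : R :=
  surplus x w t - dividends alpha w t + injections alpha w t.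

Definition admissible (x : R) (alpha : strategy) : Prop :=
  let Z := dividends alpha in
  let K := injections alpha in
  let X := controlled_surplus x alpha in
  [/\ adapted Ft (fun w t => Z w t) /\ adapted Ft (fun w t => K w t),
      forall w t, t < 0 -> Z w t = 0 /\ K w t = 0,
      forall w t, 0 <= t ->
        Z w s @[s --> t^'+] --> Z w t /\ cvg (Z w s @[s --> t^'-]),
      forall w t, 0 <= t ->
        K w s @[s --> t^'-] --> K w t /\ cvg (K w s @[s --> t^'+])
    & forall w t, 0 <= t ->
        Z w t - lim (Z w s @[s --> t^'-]) <=
        Num.max 0 (lim (X w s @[s --> t^'-]) +
                   surplus 0 w t - lim (surplus 0 w s @[s --> t^'-]))].

Definition ruin_time (x : R) (alpha : strategy) (w : Omega) : \bar R :=
  ereal_inf [set t%:E | t in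
    [set t | 0 <= t /\ lim (controlled_surplus x alpha w s @[s --> t^'+]) < 0]].

Definition discounted_total (A : monotone_path R) (T : \bar R) : \bar R :=
  (\int[stieltjes A]_(s in [set s : R | (0 <= s)%R /\ s%:E <= T])
     (expR (- rho * s))%:E)%E.

(* A difference [+oo - +oo] is [-oo] by convention in [\bar R]; for an
   admissible strategy it means that both discounted totals diverge up to an
   infinite ruin time, and the truncated rewards then tend to [-oo]. *)
Definition reward (x : R) (alpha : strategy) : \bar R :=
  (\int[P]_w (discounted_total (dividends alpha w) (ruin_time x alpha w) -
     delta%:E * discounted_total (injections alpha w) (ruin_time x alpha w)))%E.

Definition value_function (x : R) : \bar R :=
  ereal_sup [set reward x alpha | alpha in admissible x].

End Control.

(* Main.v *)
Require Import Defs.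
From mathcomp Require Import all_boot all_order all_algebra.
From mathcomp Require Import all_classical all_reals all_analysis.
From mathcomp Require Import measurable_realfun.
From mathcomp Require Import ring lra.

Import Order.TTheory GRing.Theory Num.Theory.
Import numFieldNormedType.Exports.

Local Open Scope classical_set_scope.
Local Open Scope ring_scope.

Set Implicit Arguments.
Unset Strict Implicit.
Unset Printing Implicit Defensive.

(** Starting from [x'] instead of [x], pay the extra [x' - x] as a dividend at
time 0 and then follow any strategy that is admissible for [x].  From time 0 on
the controlled surplus is the one that starts from [x], so the strategy is
admissible ([pay_lump_admissible]), the ruin time is the same
([ruin_time_pay_lump]) and the discounted gain is larger by exactly [x' - x]
([gain_pay_lump]).  Taking expectations and then suprema gives
[v(x) + (x' - x) <= v(x')].

Two analytic points remain.  The inequality is about a difference of extended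
reals, so [v(x)] has to be finite.  It is nonnegative because doing nothing is
admissible.  It is bounded because, up to ruin, dividends never exceed
[x + c t] plus the injections ([dividends_le]), so that their discounted total
exceeds that of the injections by at most a constant ([discounted_total_le]);
as [1 < delta], the gain is then bounded path by path ([gain_le]).  Moreover
the expectation has to commute with adding the constant [x' - x]; this needs
the gain to be a measurable function of the outcome ([measurable_gain]).

Both points rest on one formula, [discounted_totalE]: writing
[e^{-rho s}] as the integral of the exponential density [rho e^{-rho u}] over
[u >= s] and exchanging the integrals (Tonelli) turns a Stieltjes integral
against [dA] into a Lebesgue integral of the values of [A],
[int_{[0,T]} e^{-rho s} dA_s = int_0^oo rho e^{-rho u} A_{(u /\ T)^+} du].
In this form an inequality between paths, a jump at time 0 and measurability in
the outcome pass from the paths to their discounted totals. *)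

(** * One-sided limits *)

Lemma near_eq_fmap (R : realType) (F : set_system R) {FF : Filter F}
  (f g : R -> R) : (\forall s \near F, f s = g s) -> f @ F = g @ F.
Proof.
move=> fg; apply/seteqP; split; apply: near_eq_cvg => //.
by near=> s; apply/esym; near: s.
Unshelve. all: by end_near. Qed.

Lemma left_lim_at0 (R : realType) (X : R -> R) (v : R) :
  (forall s, s < 0 -> X s = v) -> lim (X s @[s --> 0^'-]) = v.
Proof.
move=> Xv; apply/cvg_lim => //.
apply: (@cvg_trans _ ((fun=> v) s @[s --> (0:R)^'-])); last exact: cvg_cst.
by apply: near_eq_cvg; near=> s; rewrite Xv.
Unshelve. all: by end_near. Qed.

(** * Discounted totals *)

Section StieltjesLayerCake.
Context {R : realType}.
Implicit Types (A B : monotone_path R) (T : \bar R).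

Lemma right_lim_id A t : A s @[s --> t^'+] --> A t -> right_lim A t = A t.
Proof. by move=> /cvg_lim; exact. Qed.

Lemma right_lim_lt0 A t : (forall s, s < 0 -> A s = 0) -> t < 0 ->
  right_lim A t = 0.
Proof.
move=> A0 t0; apply/cvg_lim => //.
apply: (@cvg_trans _ ((fun=> 0 : R) s @[s --> t^'+])); last exact: cvg_cst.
apply: near_eq_cvg; near=> s; rewrite A0//.
Unshelve. all: by end_near. Qed.

Lemma right_lim_ge0 A t : (forall s, s < 0 -> A s = 0) -> 0 <= right_lim A t.
Proof.
move=> A0; have [t0|t0] := ltP t 0; first by rewrite right_lim_lt0.
rewrite -(@right_lim_lt0 A (-1))// ?ltrN10//.
by apply: right_lim_nondecreasing; rewrite (le_trans _ t0)// lerN10.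
Qed.

Lemma stieltjes_itvoc A (a b : R) : a <= b ->
  stieltjes A `]a, b]%classic = (right_lim A b - right_lim A a)%:E.
Proof.
move=> ab; rewrite /stieltjes /lebesgue_stieltjes_measure /measure_extension/=.
by rewrite measurable_mu_extE/= ?wlength_itv_bnd//; exact: is_ocitv.
Qed.

(** The atom at 0 counts: it has mass [A_{0^+}], because [A] vanishes before 0.
The closed interval is reached as a decreasing intersection of left-open ones. *)
Lemma stieltjes_itvcc0 A b : (forall s, s < 0 -> A s = 0) -> 0 <= b ->
  stieltjes A `[0, b]%classic = (right_lim A b)%:E.
Proof.
move=> A0 b0; pose F n : set R := `]- n.+1%:R^-1, b]%classic.
have n0 n : - n.+1%:R^-1 < 0 :> R by rewrite oppr_lt0 invr_gt0 ltr0n.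
have FE n : stieltjes A (F n) = (right_lim A b)%:E.
  rewrite stieltjes_itvoc; last exact: le_trans (ltW (n0 n)) b0.
  by rewrite (right_lim_lt0 A0 (n0 n)) subr0.
have capF : \bigcap_n F n = `[0, b]%classic.
  apply/seteqP; split => s /=.
    move=> Fs; rewrite in_itv/=; apply/andP; split; last first.
      by have := Fs 0%N I; rewrite /F/= in_itv/= => /andP[].
    rewrite leNgt; apply/negP => s0.
    have : \forall n \near \oo, n.+1%:R^-1 < - s.
      by apply: near_infty_natSinv_lt (PosNum _); rewrite oppr_gt0.
    case=> n _ /(_ n (leqnn n))/= ns.
    by have := Fs n I; rewrite /F/= in_itv/= ltrNl ltNge (ltW ns).
  rewrite in_itv/= => /andP[s0 sb] n _; rewrite /F/= in_itv/= sb andbT.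
  exact: lt_le_trans (n0 n) s0.
have : stieltjes A (F n) @[n --> \oo] --> stieltjes A (\bigcap_n F n).
  apply: nonincreasing_cvg_mu.
  - have : (stieltjes A (F 0%N) < +oo)%E by rewrite FE ltry.
    exact.
  - by move=> n; exact: measurable_itv.
  - by rewrite capF; exact: measurable_itv.
  move=> m n mn; apply/subsetPset => s; rewrite /F/= !in_itv/= => /andP[+ ->].
  by rewrite andbT; apply: le_lt_trans; rewrite lerN2 lef_pV2 ?posrE ?ler_nat.
rewrite capF; under eq_fun do rewrite FE.
by move=> /cvg_lim <-//; rewrite lim_cst.
Qed.

(** [min u T] as a real number, for a possibly infinite horizon [T >= 0]. *)
Definition cut_time T (u : R) : R := fine (mine u%:E T).

Lemma cut_timeE T u : (0 <= T)%E -> (cut_time T u)%:E = mine u%:E T.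
Proof.
by rewrite /cut_time => T0; have [//|/ltW Tu] := leP u%:E T; case: T T0 Tu.
Qed.

Lemma le_cut_time T u s : (0 <= T)%E ->
  (s <= cut_time T u) = (s <= u) && (s%:E <= T)%E.
Proof. by move=> T0; rewrite -lee_fin cut_timeE// le_min lee_fin. Qed.

Lemma cut_time_ge0 T u : (0 <= T)%E -> 0 <= u -> 0 <= cut_time T u.
Proof. by move=> T0 u0; rewrite le_cut_time// u0. Qed.

Lemma exponential_tail (rho s : R) : 0 < rho -> 0 <= s ->
  (\int[lebesgue_measure]_(u in `[s, +oo[) (exponential_pdf rho u)%:E =
   (expR (- rho * s))%:E)%E.
Proof.
move=> rho0 s0.
have cexp : continuous (fun z : R^o => expR (- rho * z)).
  move=> z; apply: continuous_comp; last exact: continuous_expR.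
  by apply: continuousM => //; apply: (@continuousN _ R^o); exact: cst_continuous.
rewrite (@ge0_continuous_FTC2y _ _ (fun x => - expR (- rho * x)) _ 0)//.
- by rewrite EFinN oppeK add0e.
- by move=> u _; apply: exponential_pdf_ge0; exact: ltW.
- apply: (@continuous_subspaceW R^o _ _ [set` `[0, +oo[%R]).
    by apply: subset_itvr; rewrite bnd_simp.
  exact: within_continuous_exponential_pdf.
- rewrite -oppr0; apply: cvgN.
  rewrite (_ : (fun x => _) = (fun z => expR (- z)) \o (fun z => rho * z)).
    apply: (@cvg_comp _ _ _ _ _ _ (pinfty_nbhs R)); last exact: cvgr_expR.
    exact: gt0_cvgMry.
  by apply: eq_fun => x; rewrite mulNr.
- by apply: cvgN; apply/cvg_at_right_filter; exact: cexp.
- move=> u; rewrite in_itv/= andbT => su; apply: derive1_exponential_pdf.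
  by rewrite in_itv/= andbT (le_lt_trans s0).
Qed.

(** Layer-cake formula.  For [s >= 0] the weight [e^{-rho s}] is the mass that the
exponential density gives to [[s, +oo[]; by Tonelli it remains to measure, for
each [u], the set of the [s] in [[0, T]] below [u], which is
[[0, min u T]]. *)
Lemma discounted_totalE (rho : R) A T : 0 < rho -> (0 <= T)%E ->
    (forall s, s < 0 -> A s = 0) ->
  discounted_total rho A T =
  (\int[lebesgue_measure]_u
     ((exponential_pdf rho u)%:E * (right_lim A (cut_time T u))%:E))%E.
Proof.
move=> rho0 T0 A0.
pose S := [set s : R | (0 <= s)%R /\ (s%:E <= T)%E].
have mS : measurable S.
  rewrite (_ : S = `[0, +oo[ `&` (setT `&` [set s | (s%:E <= T)%E])).
    by apply: measurableI => //; apply: emeasurable_fun_infty_c.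
  by rewrite setTI; apply/seteqP; split => s; rewrite /S/= in_itv/= andbT.
pose E := [set z : measurableTypeR R * measurableTypeR R | S z.1 /\ z.1 <= z.2].
have mE : measurable E.
  have -> : E = (setT `&` fst @^-1` S) `&`
      (setT `&` (fun z => z.2 - z.1) @^-1` `[0, +oo[).
    by rewrite !setTI; apply/seteqP; split => z; rewrite /E/= in_itv/= andbT subr_ge0.
  apply: measurableI; first by apply: measurable_fst.
  by apply: (measurable_funB measurable_snd measurable_fst).
pose h (z : measurableTypeR R * measurableTypeR R) :=
  (\1_E z * exponential_pdf rho z.2)%:E.
have pdf0 u : 0 <= exponential_pdf rho u by apply: exponential_pdf_ge0; exact: ltW.
have h0 z : (0 <= h z)%E by rewrite lee_fin mulr_ge0.
have mh : measurable_fun setT h.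
  apply/measurable_EFinP; apply: measurable_funM; first exact: measurable_indic.
  apply: measurableT_comp => //; exact: measurable_exponential_pdf.
transitivity (\int[stieltjes A]_s \int[lebesgue_measure]_u h (s, u))%E.
  rewrite /discounted_total integral_mkcond; apply: eq_integral => s _.
  rewrite patchE; case: ifPn => [/set_mem/= Ss|/negP Ss].
    rewrite -exponential_tail//; last by case: Ss.
    rewrite integral_mkcond; apply: eq_integral => u _.
    rewrite patchE /h/= indicE.
    case: ifPn => [/set_mem/=|/negP su]; rewrite ?in_itv/= ?andbT.
      by move=> su; rewrite mem_set ?mul1r.
    rewrite memNset ?mul0r//= => -[_ le_su]; apply: su.
    by apply/mem_set; rewrite /= in_itv/= andbT.
  rewrite integral0_eq// => u _; rewrite /h/= indicE memNset ?mul0r//=.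
  by move=> [Ss' _]; apply: Ss; exact/mem_set.
rewrite /stieltjes (fubini_tonelli h)//; apply: eq_integral => u _.
rewrite (_ : (fun s => h (s, u)) = fun s =>
    ((exponential_pdf rho u)%:E * (\1_(S `&` [set s | (s <= u)%R]) s)%:E)%E); last first.
  by apply/funext => s; rewrite /h -EFinM mulrC !indicE.
have mSu : measurable (S `&` [set s | s <= u]).
  by apply: measurableI => //; rewrite -set_itvNyc; exact: measurable_itv.
rewrite ge0_integralZl// ?lee_fin//.
- have [u0|u0] := ltP u 0.
    by rewrite lt0_exponential_pdf ?mul0e.
  congr (_ * _)%E; rewrite integral_indic// ?setIT.
  rewrite -(stieltjes_itvcc0 A0 (cut_time_ge0 T0 u0)).
  congr (stieltjes A _); apply/seteqP; split => s/=; rewrite in_itv/= le_cut_time//.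
    by case=> -[-> ->] ->.
  by case/and3P.
- apply/measurable_EFinP; exact: measurable_indic.
Qed.

Lemma measurable_cut_time d (S : measurableType d) (D : set S)
    (T : S -> \bar R) (f : S -> R) :
  measurable_fun D T -> measurable_fun D f ->
  measurable_fun D (fun w => cut_time (T w) (f w)).
Proof.
move=> mT mf; apply: (measurableT_comp (f := fine)) => //.
by apply: measurable_mine => //; exact/measurable_EFinP.
Qed.

Lemma measurable_weighted_right_lim (rho : R) A T : 0 < rho -> measurable_fun setT
  (fun u => (exponential_pdf rho u)%:E * (right_lim A (cut_time T u))%:E)%E.
Proof.
move=> rho0; apply/measurable_EFinP; apply: measurable_funM.
  exact: measurable_exponential_pdf.
have mcut : measurable_fun setT (cut_time T).
  exact: (measurable_cut_time (measurable_cst T) (@measurable_id _ _ setT)).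
apply: (measurableT_comp (f := right_lim A)) mcut.
by apply: nondecreasing_measurable => //; exact: right_lim_nondecreasing.
Qed.

Lemma discounted_total_ge0 (rho : R) A T : (0 <= discounted_total rho A T)%E.
Proof. by apply: integral_ge0 => s _; rewrite lee_fin expR_ge0. Qed.

Lemma discounted_total_null (rho : R) A T : 0 < rho -> (0 <= T)%E ->
  (forall s, A s = 0) -> discounted_total rho A T = 0%E.
Proof.
move=> rho0 T0 A0; rewrite discounted_totalE// integral0_eq// => u _.
by rewrite right_lim_id ?A0 ?mule0//; under eq_fun do rewrite A0; exact: cvg_cst.
Qed.

(** A jump of size [r] at time 0 is not discounted, which in the layer-cake
formula is the fact that the exponential density has total mass 1. *)
Lemma discounted_total_shift (rho r : R) A A' T : 0 < rho -> (0 <= T)%E ->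
    0 <= r -> (forall s, s < 0 -> A s = 0) -> (forall s, s < 0 -> A' s = 0) ->
    (forall s, 0 <= s -> right_lim A' s = right_lim A s + r) ->
  discounted_total rho A' T = (discounted_total rho A T + r%:E)%E.
Proof.
move=> rho0 T0 r0 A0 A'0 A'E; rewrite !discounted_totalE//.
have pdf0 u : 0 <= exponential_pdf rho u by apply: exponential_pdf_ge0; exact: ltW.
have mpdf := measurable_exponential_pdf rho.
rewrite -[X in (_ + X)%E]mule1 -(integral_exponential_pdf rho0).
rewrite -ge0_integralZl//; last 2 first.
- exact/measurable_EFinP.
- by move=> u _; rewrite lee_fin.
rewrite -ge0_integralD//; first last.
- by apply/measurable_EFinP; apply: measurable_funM.
- by move=> u _; rewrite -EFinM lee_fin mulr_ge0.
- exact: measurable_weighted_right_lim.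
- by move=> u _; rewrite -EFinM lee_fin mulr_ge0// right_lim_ge0.
apply: eq_integral => u _; have [u0|u0] := ltP u 0.
  by rewrite lt0_exponential_pdf// !mul0e mule0 adde0.
by rewrite A'E ?cut_time_ge0// EFinD muleDr// (muleC r%:E).
Qed.

(** Integrating the hypothesis against the exponential density leaves a constant
that only has to be finite.  The term [c u] is absorbed by half of the
exponential decay: since [rho / 2 * u <= e^{(rho / 2) u}], the product of [c u]
with the density of rate [rho] is at most [4 c / rho] times the density of rate
[rho / 2]. *)
Lemma discounted_total_le (rho x c : R) A B T : 0 < rho -> (0 <= T)%E ->
    0 <= x -> 0 <= c ->
    (forall s, s < 0 -> A s = 0) -> (forall s, s < 0 -> B s = 0) ->
    (forall s, 0 <= s -> (s%:E <= T)%E ->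
       right_lim A s <= x + c * s + right_lim B s) ->
  (discounted_total rho A T <=
     (x + 4 * c / rho)%:E + discounted_total rho B T)%E.
Proof.
move=> rho0 T0 x0 c0 A0 B0 AB; rewrite !discounted_totalE//.
have rho20 : 0 < rho / 2 by rewrite divr_gt0.
have pdf0 (p u : R) : 0 < p -> 0 <= exponential_pdf p u.
  by move=> p0; apply: exponential_pdf_ge0; exact: ltW.
have mpdf (p : R) := measurable_exponential_pdf p.
have C0 : 0 <= 4 * c / rho by rewrite divr_ge0 ?mulr_ge0// ltW.
have intZ (k p : R) : 0 <= k -> 0 < p ->
    (k%:E = \int[lebesgue_measure]_u (k%:E * (exponential_pdf p u)%:E))%E.
  move=> k0 p0; rewrite ge0_integralZl//.
  - by rewrite integral_exponential_pdf ?mule1.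
  - by apply/measurable_EFinP; exact: mpdf.
  - by move=> u _; rewrite lee_fin pdf0.
have mZ (k p : R) : measurable_fun setT (fun u => k%:E * (exponential_pdf p u)%:E)%E.
  by apply/measurable_EFinP; exact: measurable_funM.
have Z0 (k p : R) u : 0 <= k -> 0 < p -> (0 <= k%:E * (exponential_pdf p u)%:E)%E.
  by move=> k0 p0; rewrite -EFinM lee_fin mulr_ge0// pdf0.
rewrite EFinD (intZ _ _ x0 rho0) (intZ _ _ C0 rho20).
rewrite -ge0_integralD//;
  [|by move=> u _; exact: Z0|exact: mZ|by move=> u _; exact: Z0|exact: mZ].
have mZZ : measurable_fun setT (fun u : R => x%:E * (exponential_pdf rho u)%:E +
    (4 * c / rho)%:E * (exponential_pdf (rho / 2) u)%:E)%E.
  by apply: emeasurable_funD; exact: mZ.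
have mB := measurable_weighted_right_lim B T rho0.
have B'0 u : (0 <= (exponential_pdf rho u)%:E * (right_lim B (cut_time T u))%:E)%E.
  by rewrite -EFinM lee_fin mulr_ge0 ?pdf0// right_lim_ge0.
rewrite -ge0_integralD//; last first.
  by move=> u _; rewrite adde_ge0// Z0.
apply: ge0_le_integral => //.
- by move=> u _; rewrite -EFinM lee_fin mulr_ge0 ?pdf0// right_lim_ge0.
- exact: measurable_weighted_right_lim.
- exact: emeasurable_funD.
move=> u _; have [u0|u0] := ltP u 0.
  by rewrite !lt0_exponential_pdf// !mul0e !mule0 !adde0.
have cut0 := cut_time_ge0 T0 u0.
have /andP[cutu cutT] : (cut_time T u <= u) && ((cut_time T u)%:E <= T)%E.
  by rewrite -le_cut_time.
rewrite -!EFinM -!EFinD lee_fin.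
have cu : c * u <= 2 * c / rho * expR (rho / 2 * u).
  have : rho / 2 * u <= expR (rho / 2 * u).
    by apply: le_trans (expR_ge1Dx _); rewrite lerDr.
  move=> /(ler_wpM2l (_ : 0 <= 2 * c / rho)); rewrite divr_ge0 ?mulr_ge0 ?(ltW rho0)//.
  move=> /(_ erefl); apply: le_trans; rewrite le_eqVlt; apply/orP; left; apply/eqP.
  by field; rewrite gt_eqF.
apply: (@le_trans _ _ (exponential_pdf rho u * (x + c * u + right_lim B (cut_time T u)))).
  rewrite ler_wpM2l ?pdf0// (le_trans (AB _ cut0 cutT))// lerD2r lerD2l.
  by rewrite ler_wpM2l.
rewrite !mulrDr lerD2r (mulrC x) lerD2l.
rewrite !exponential_pdfE//.
apply: (@le_trans _ _ (rho * expR (- rho * u) * (2 * c / rho * expR (rho / 2 * u)))).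
  by rewrite ler_wpM2l// mulr_ge0 ?expR_ge0// ltW.
rewrite (_ : - rho * u = - (rho / 2) * u + - (rho / 2) * u); last by field.
rewrite expRD (_ : rho / 2 * u = - (- (rho / 2) * u)); last by field.
rewrite expRN le_eqVlt; apply/orP; left; apply/eqP; field.
by rewrite !gt_eqF ?expR_gt0.
Qed.

End StieltjesLayerCake.

(** * Measurability in the outcome *)

Section MeasurabilityInOmega.
Context {R : realType} {d : measure_display} {Omega : measurableType d}.

(** Joint measurability comes from monotonicity: [A_{u^+} < r] if and only if
[A_q < r] for some rational [q > u], so each strict sublevel set is a countable
union of rectangles. *)
Lemma measurable_right_lim (A : Omega -> monotone_path R) :
    (forall t, measurable_fun setT (fun w => A w t)) ->
  measurable_fun [set: Omega * measurableTypeR R]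
    (fun z => right_lim (A z.1) z.2).
Proof.
move=> mA; apply: (measurability (@RGenInftyO.G R)).
  exact: RGenInftyO.measurableE.
move=> _ [_ [r ->] <-]; rewrite setTI.
rewrite (_ : _ @^-1` _ = \bigcup_(q : rat)
    (((fun w => A w (ratr q)) @^-1` `]-oo, r[) `*` `]-oo, ratr q[)).
  apply: bigcupT_measurable_rat => q; apply: measurableX => //.
  by rewrite -[X in measurable X]setTI; exact: mA.
apply/seteqP; split => -[w u]/=; rewrite in_itv/=.
  move=> Aur; have /cvgr_lt/(_ _ Aur) Ar := @right_lim_cvg _ (A w) u.
  have [v [uv Av]] : exists v, u < v /\ A w v < r.
    near u^'+ => v; exists v; split; first by near: v; exact: nbhs_right_gt.
    by near: v; exact: Ar.
  have [q] := rat_in_itvoo uv; rewrite in_itv/= => /andP[uq qv].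
  exists q => //; split; rewrite /= in_itv//=.
  by rewrite (le_lt_trans _ Av)// path_nondecreasing// ltW.
move=> [q _ [/=]]; rewrite !in_itv/= => Ar uq.
exact: le_lt_trans (right_lim_le _ uq) Ar.
Unshelve. all: by end_near. Qed.

Lemma measurable_discounted_total (rho : R) (A : Omega -> monotone_path R)
    (T : Omega -> \bar R) :
    0 < rho -> (forall t, measurable_fun setT (fun w => A w t)) ->
    (forall w s, s < 0 -> A w s = 0) ->
    measurable_fun setT T -> (forall w, (0 <= T w)%E) ->
  measurable_fun setT (fun w => discounted_total rho (A w) (T w)).
Proof.
move=> rho0 mA A0 mT T0.
rewrite (_ : (fun w => _) = fun w => (\int[lebesgue_measure]_u
    ((exponential_pdf rho u)%:E * (right_lim (A w) (cut_time (T w) u))%:E))%E);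
  last by apply/funext => w; exact: (discounted_totalE rho0 (T0 w) (A0 w)).
pose f (z : Omega * measurableTypeR R) := ((exponential_pdf rho z.2)%:E *
  (right_lim (A z.1) (cut_time (T z.1) z.2))%:E)%E.
apply: (measurable_fun_fubini_tonelli_F f).
  apply/measurable_EFinP; apply: measurable_funM.
    exact: (measurableT_comp (measurable_exponential_pdf rho) measurable_snd).
  apply: (measurableT_comp (measurable_right_lim mA)
    (g := fun z : Omega * measurableTypeR R => (z.1, cut_time (T z.1) z.2))).
  apply: measurable_fun_pair; first exact: measurable_fst.
  apply: measurable_cut_time; last exact: measurable_snd.
  exact: (measurableT_comp mT measurable_fst).
move=> z; rewrite /f -EFinM lee_fin mulr_ge0 ?right_lim_ge0//; last exact: A0.
by apply: exponential_pdf_ge0; exact: ltW.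
Qed.

(** The regularized path [t |-> X_{t^+}] is right-continuous, hence stays negative
for a while once it is negative.  This is what lets rational times detect
ruin. *)
Lemma right_limit_lt0_near (X : R -> R) t :
    (\forall s \near t^'+, cvg (X u @[u --> s^'+])) ->
    cvg (X u @[u --> t^'+]) -> lim (X u @[u --> t^'+]) < 0 ->
  \forall s \near t^'+, lim (X u @[u --> s^'+]) < 0.
Proof.
move=> cX cXt Xt0; pose m := lim (X u @[u --> t^'+]) / 2.
have m0 : m < 0 by rewrite /m pmulr_llt0.
have Xm : lim (X u @[u --> t^'+]) < m by rewrite /m; lra.
have /cvgr_lt/(_ _ Xm) := cXt; rewrite near_withinE => -[e /= e0 He].
near=> s; apply: le_lt_trans m0; apply: limr_le; first by near: s.
have ts : t < s by near: s; exact: nbhs_right_gt.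
have ste : s < t + e by near: s; apply: nbhs_right_lt; rewrite ltrDl.
near=> u.
have su : s < u by near: u; exact: nbhs_right_gt.
have ue : u < t + e by near: u; exact: nbhs_right_lt.
apply/ltW/He; last exact: lt_trans su.
by rewrite /= distrC ger0_norm ?subr_ge0 ?(ltW (lt_trans ts su))// ltrBlDl.
Unshelve. all: by end_near. Qed.

Lemma measurable_first_passage (X : Omega -> R -> R) :
    (forall w t, 0 <= t -> cvg (X w s @[s --> t^'+])) ->
    (forall t, 0 <= t ->
       measurable_fun setT (fun w => lim (X w s @[s --> t^'+]))) ->
  measurable_fun setT (fun w => ereal_inf [set t%:E | t in
    [set t | 0 <= t /\ lim (X w s @[s --> t^'+]) < 0]]).
Proof.
move=> cX mX; apply: (measurability (@ErealGenInftyO.G R)).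
  exact: ErealGenInftyO.measurableE.
move=> _ [_ [r ->] <-]; rewrite setTI.
pose F (q : rat) : set Omega := if (0 <= ratr q :> R) && (ratr q < r) then
  [set w | lim (X w s @[s --> (ratr q : R)^'+]) < 0] else set0.
rewrite (_ : _ @^-1` _ = \bigcup_q F q); last first.
  apply/seteqP; split => w/=; rewrite in_itv/=.
    move=> /ereal_inf_ltP[_ [t [t0 Xt]] <-].
    rewrite lte_fin => tr.
    have Xnear : \forall s \near t^'+, lim (X w u @[u --> s^'+]) < 0.
      apply: right_limit_lt0_near Xt; last exact: cX.
      by near=> s; apply: cX; rewrite (le_trans t0).
    have := Xnear; rewrite near_withinE => -[e /= e0 He].
    have tm : t < Num.min r (t + e) by rewrite lt_min tr ltrDl.
    have [q] := rat_in_itvoo tm; rewrite in_itv/= lt_min => /and3P[tq qr qe].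
    exists q => //; rewrite /F qr (le_trans t0 (ltW tq))/=.
    apply: He => //=.
    by rewrite distrC ger0_norm ?subr_ge0 ?(ltW tq)// ltrBlDl.
  move=> [q _]; rewrite /F; case: ifPn => // /andP[q0 qr] Xq.
  apply/ereal_inf_ltP; exists (ratr q)%:E => //.
  by exists (ratr q).
apply: bigcupT_measurable_rat => q; rewrite /F; case: ifPn => // /andP[q0 _].
rewrite (_ : [set w | _] = setT `&` (fun w => lim (X w s @[s --> (ratr q : R)^'+]))
   @^-1` `]-oo, 0[); first exact: mX.
by rewrite setTI; apply/seteqP; split => w/=; rewrite in_itv.
Unshelve. all: by end_near. Qed.

End MeasurabilityInOmega.

(** * Controlled surplus and ruin *)

Section ControlledSurplus.
Context {R : realType} {d : measure_display} {Omega : measurableType d}.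
Variables (P : probability Omega R) (Ft : R -> set (set Omega)).
Variables (c : R) (N : Omega -> R -> nat) (Y : nat -> {RV P >-> R}).
Hypotheses (hFt : usual_filtration P Ft) (hc : 0 < c).
Hypotheses (hN : counting_process N) (hNad : adapted Ft N).
Hypothesis hY : forall k w, 0 < Y k w.

Local Notation claims w n := (\sum_(k < n) Y k w).

Let claims_nondecreasing w (m n : nat) : (m <= n)%N -> claims w m <= claims w n.
Proof.
move=> mn; rewrite -(subnKC mn) big_split_ord/= lerDl sumr_ge0// => k _.
exact/ltW/hY.
Qed.

Lemma surplusD x w t : surplus c N Y x w t = x + surplus c N Y 0 w t.
Proof. by rewrite /surplus add0r addrA. Qed.

Lemma surplus_le0 x w t : t <= 0 -> surplus c N Y x w t = x.
Proof.
move=> t0; have [N0 _ _ _] := hN w.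
by rewrite /surplus N0// big_ord0 subr0 max_l// mulr0 addr0.
Qed.

Lemma surplus_le x w t : 0 <= t -> surplus c N Y x w t <= x + c * t.
Proof.
move=> t0; rewrite /surplus max_r// lerBlDr lerDl sumr_ge0// => k _.
exact/ltW/hY.
Qed.

Let cvg_premium (x t : R) (F : set_system R) {FF : Filter F} : F --> t ->
  x + c * Num.max 0 s @[s --> F] --> x + c * Num.max 0 t.
Proof.
move=> Ft'; apply: cvgD; first exact: cvg_cst.
apply: cvgM; first exact: cvg_cst.
apply: (cvg_comp idfun (fun s : R => Num.max 0 s) Ft').
apply: (@continuous_max _ R^o (fun=> 0) idfun); first exact: cst_continuous.
exact: cvg_id.
Qed.

Lemma surplus_right_continuous x w t :
  surplus c N Y x w s @[s --> t^'+] --> surplus c N Y x w t.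
Proof.
have [_ _ Nr _] := hN w.
apply: (@cvg_trans _ (x + c * Num.max 0 s - claims w (N w t) @[s --> t^'+])).
  apply: near_eq_cvg; near=> s; rewrite /surplus; congr (_ - _).
  by have -> : N w s = N w t by near: s; exact: Nr.
apply: cvgB; last exact: cvg_cst.
by apply: cvg_premium; apply: cvg_within.
Unshelve. all: by end_near. Qed.

Lemma surplus_left_cvg x w t : cvg (surplus c N Y x w s @[s --> t^'-]).
Proof.
have [_ Nnd _ _] := hN w.
apply: is_cvgB.
  by apply/cvg_ex; exists (x + c * Num.max 0 t); apply: cvg_premium; apply: cvg_within.
apply: (nondecreasing_at_left_is_cvgr (f := fun s => claims w (N w s))).
  by near=> e => u v _ _ uv; apply: claims_nondecreasing; exact: Nnd.
near=> e; exists (claims w (N w t)) => _ [u /= + <-].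
by rewrite in_itv/= => /andP[_ /ltW ut]; apply: claims_nondecreasing; exact: Nnd.
Unshelve. all: by end_near. Qed.

(** The number of claims takes countably many values; the sum is measurable on
each event [N_t = n]. *)
Lemma measurable_surplus x t : 0 <= t ->
  measurable_fun setT (fun w => surplus c N Y x w t).
Proof.
move=> t0; apply: measurable_funB => // _ B mB; rewrite setTI.
rewrite (_ : _ @^-1` _ = \bigcup_n ([set w | N w t = n] `&`
    ((fun w => claims w n) @^-1` B))); last first.
  apply/seteqP; split => w/=; first by move=> ?; exists (N w t).
  by move=> [n _ [<-]].
apply: bigcupT_measurable => n; apply: measurableI.
  have [/(_ _ t0)[_ sub] _ _ _] := hFt.
  by apply: sub; exact: (hNad t0 (B := [set n])).
rewrite -[X in measurable X]setTI.
by apply: measurable_sum => // k; exact: measurable_funPT.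
Qed.

Section AdmissibleStrategy.
Variables (x : R) (alpha : @strategy R d Omega).
Hypothesis halpha : admissible Ft c N Y x alpha.
Local Notation Z := (dividends alpha).
Local Notation K := (injections alpha).
Local Notation X := (controlled_surplus c N Y x alpha).

Lemma dividends_lt0 w s : s < 0 -> Z w s = 0.
Proof. by move=> s0; have [_ /(_ w _ s0)[]] := halpha. Qed.

Lemma injections_lt0 w s : s < 0 -> K w s = 0.
Proof. by move=> s0; have [_ /(_ w _ s0)[]] := halpha. Qed.

Lemma right_lim_dividends w t : 0 <= t -> right_lim (Z w) t = Z w t.
Proof. by move=> t0; apply: right_lim_id; have [_ _ /(_ w _ t0)[]] := halpha. Qed.

Let measurable_of_adapted (A : Omega -> R -> R) t : 0 <= t -> adapted Ft A ->
  measurable_fun setT (fun w => A w t).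
Proof.
move=> t0 adA _ B mB; rewrite setTI; have [/(_ _ t0)[_ sub] _ _ _] := hFt.
by apply: sub; exact: adA.
Qed.

Lemma measurable_dividends t : measurable_fun setT (fun w => Z w t).
Proof.
have [t0|t0] := ltP t 0.
  by rewrite (_ : (fun w => _) = cst 0)//; apply/funext => w; exact: dividends_lt0.
by have [[adZ _] _ _ _ _] := halpha; exact: (measurable_of_adapted t0 adZ).
Qed.

Lemma measurable_injections t : measurable_fun setT (fun w => K w t).
Proof.
have [t0|t0] := ltP t 0.
  by rewrite (_ : (fun w => _) = cst 0)//; apply/funext => w; exact: injections_lt0.
by have [[_ adK] _ _ _ _] := halpha; exact: (measurable_of_adapted t0 adK).
Qed.

Lemma controlled_surplus_right_cvg w t : 0 <= t ->
  X w s @[s --> t^'+] -->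
  surplus c N Y x w t - Z w t + right_lim (K w) t.
Proof.
move=> t0; apply: cvgD; last exact: right_lim_cvg.
apply: cvgB; first exact: surplus_right_continuous.
by have [_ _ /(_ w _ t0)[]] := halpha.
Qed.

Lemma ruin_time_ge0 w : (0 <= ruin_time c N Y x alpha w)%E.
Proof. by apply: le_ereal_inf_tmp => _ [t [t0 _] <-]; rewrite lee_fin. Qed.

Lemma measurable_ruin_time : measurable_fun setT (ruin_time c N Y x alpha).
Proof.
apply: measurable_first_passage => [w t t0|t t0].
  by apply/cvg_ex; eexists; exact: controlled_surplus_right_cvg.
rewrite (_ : (fun w => _) = fun w =>
    surplus c N Y x w t - Z w t + right_lim (K w) t); last first.
  by apply/funext => w; apply/cvg_lim => //; exact: controlled_surplus_right_cvg.
apply: measurable_funD.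
  apply: measurable_funB; first exact: measurable_surplus.
  exact: measurable_dividends.
have mK := measurable_right_lim measurable_injections.
exact: (measurableT_comp mK (measurable_fun_pair (@measurable_id _ _ setT)
  (measurable_cst t))).
Qed.

Lemma surplus_before_ruin_ge0 w t : 0 <= t ->
  (t%:E < ruin_time c N Y x alpha w)%E ->
  0 <= surplus c N Y x w t - Z w t + right_lim (K w) t.
Proof.
move=> t0 tT; rewrite leNgt; apply/negP => Xt; move: tT; apply/negP.
rewrite -leNgt; apply: ereal_inf_lbound; exists t => //; split => //.
by rewrite (cvg_lim _ (controlled_surplus_right_cvg t0)).
Qed.

(** The bound on jumps of [Z] leaves two cases.  If the right-hand side is the
surplus before payment, the left limits of [Z] cancel and [Z_t] is at most the
uncontrolled surplus plus [K_t].  If it is 0, then [Z] does not jump at [t]: for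
[t = 0] this gives [Z_0 = 0], and for [t > 0] the bound is the limit of
[0 <= X_{s^+}] over the [s < t], which come before ruin.  At ruin itself [X_{t^+}] may be negative, so
nonnegativity of the surplus cannot be used directly at [t]. *)
Lemma dividends_le w t : 0 <= x -> 0 <= t ->
  (t%:E <= ruin_time c N Y x alpha w)%E ->
  Z w t <= x + c * t + right_lim (K w) t.
Proof.
move=> x0 t0 tT; have [_ _ hZ hK /(_ w _ t0)] := halpha.
have [_ cZ] := hZ w _ t0; have [Kt _] := hK w _ t0.
(* [K] is left-continuous, so its left limit at [t] is [K_t]. *)
have -> : lim (X w s @[s --> t^'-]) = lim (surplus c N Y x w s @[s --> t^'-]) -
    lim (Z w s @[s --> t^'-]) + K w t.
  apply/cvg_lim => //; apply: cvgD => //; apply: cvgB => //.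
  exact: surplus_left_cvg.
have -> : lim (surplus c N Y x w s @[s --> t^'-]) =
    x + lim (surplus c N Y 0 w s @[s --> t^'-]).
  apply/cvg_lim => //; under eq_fun do rewrite surplusD.
  by apply: cvgD; [exact: cvg_cst|exact: surplus_left_cvg].
rewrite le_max => /orP[|].
  rewrite subr_le0 => Zt.
  have [t_eq0|t_neq0] := eqVneq t 0; last first.
    have {}t0 : 0 < t by rewrite lt_neqAle eq_sym t_neq0.
    apply: (le_trans Zt); apply: limr_le => //; near=> s.
    have s0 : 0 < s by near: s; exact: nbhs_left_gt.
    have st : s < t by near: s; exact: nbhs_left_lt.
    have sT : (s%:E < ruin_time c N Y x alpha w)%E.
      by apply: lt_le_trans tT; rewrite lte_fin.
    have := surplus_before_ruin_ge0 (ltW s0) sT.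
    have := surplus_le x w (ltW s0).
    have := le_trans (right_lim_le (K w) st) (right_lim_ge (K w) t).
    have : c * s <= c * t by rewrite ler_pM2l// ltW.
    lra.
  rewrite t_eq0 (left_lim_at0 (v := 0)) in Zt; last exact: dividends_lt0.
  rewrite t_eq0 mulr0 addr0 (le_trans Zt)// addr_ge0//.
  by apply: right_lim_ge0 => s; exact: injections_lt0.
have := surplus_le 0 w t0; have := right_lim_ge (K w) t.
lra.
Unshelve. all: by end_near. Qed.

End AdmissibleStrategy.
End ControlledSurplus.

(** * Expectation of a function bounded above *)

Section IntegralUpperBound.
Local Open Scope ereal_scope.
Context {R : realType} {d : measure_display} {T : measurableType d}.
Variables (P : probability T R) (g : T -> \bar R) (M : R).
Hypotheses (mg : measurable_fun setT g) (M0 : (0 <= M)%R).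
Hypothesis gM : forall w, g w <= M%:E.

Let integral_pos_le : \int[P]_w g^\+ w <= M%:E.
Proof.
rewrite -[leRHS]mule1 -(@probability_setT _ _ _ P) -integral_cst//.
apply: ge0_le_integral => //; first exact: measurable_funepos.
by move=> w _; rewrite funeposE ge_max gM lee_fin.
Qed.

Lemma integral_bounded_above : \int[P]_w g w <= M%:E.
Proof.
rewrite integralE (le_trans _ integral_pos_le)// -[leRHS]sube0.
by rewrite leeB// integral_ge0.
Qed.

(** If the expectation of [g] is [-oo] there is nothing to prove; otherwise [g],
being bounded above, is integrable and additivity applies. *)
Lemma integral_add_cst (r : R) :
  \int[P]_w g w + r%:E <= \int[P]_w (g w + r%:E).
Proof.
have [->|gNy] := eqVneq (\int[P]_w g w) -oo; first by rewrite addNye leNye.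
have intg : P.-integrable setT g.
  apply/integrableP; split => //.
  rewrite (_ : (fun w => `|g w|) = g^\+ \+ g^\-); last by rewrite -fune_abse.
  have pos_lty := le_lt_trans integral_pos_le (ltry M).
  rewrite ge0_integralD//; [|exact: measurable_funepos|exact: measurable_funeneg].
  rewrite lte_add_pinfty//.
  rewrite ltey; apply/eqP => negy; move: gNy; rewrite integralE negy.
  by rewrite addeNy.
rewrite integralD//; last exact: finite_measure_integrable_cst.
have -> // : \int[P]_w r%:E = r%:E.
by rewrite -[RHS]mule1 -(@probability_setT _ _ _ P) -integral_cst.
Qed.

End IntegralUpperBound.

(** * Gain of a strategy *)

Section Reward.
Context {R : realType} {d : measure_display} {Omega : measurableType d}.
Variables (P : probability Omega R) (Ft : R -> set (set Omega)).
Variables (c rho delta : R) (N : Omega -> R -> nat) (Y : nat -> {RV P >-> R}).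
Hypotheses (hFt : usual_filtration P Ft) (hc : 0 < c) (hrho : 0 < rho).
Hypothesis hdelta : 1 < delta.
Hypotheses (hN : counting_process N) (hNad : adapted Ft N).
Hypothesis hY : forall k w, 0 < Y k w.
Implicit Types alpha : @strategy R d Omega.

Definition gain (x : R) alpha (w : Omega) : \bar R :=
  (discounted_total rho (dividends alpha w) (ruin_time c N Y x alpha w) -
   delta%:E *
     discounted_total rho (injections alpha w) (ruin_time c N Y x alpha w))%E.

Lemma rewardE x alpha :
  reward c rho delta N Y x alpha = (\int[P]_w gain x alpha w)%E.
Proof. by []. Qed.

Lemma measurable_gain x alpha : admissible Ft c N Y x alpha ->
  measurable_fun setT (gain x alpha).
Proof.
move=> halpha; have mT := measurable_ruin_time hFt hN hNad halpha.
apply: emeasurable_funB.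
  apply: measurable_discounted_total => //; last exact: ruin_time_ge0.
    by move=> t; exact: measurable_dividends halpha t.
  by move=> w s; exact: (dividends_lt0 halpha).
apply: measurable_funeM.
apply: measurable_discounted_total => //; last exact: ruin_time_ge0.
  by move=> t; exact: measurable_injections halpha t.
by move=> w s; exact: (injections_lt0 halpha).
Qed.

(** With discounted totals [DZ <= C + DK] and [delta > 1], the gain
[DZ - delta * DK] is at most [C]; if [DK] is infinite the gain is [-oo]. *)
Lemma gain_le x alpha w : 0 <= x -> admissible Ft c N Y x alpha ->
  (gain x alpha w <= (x + 4 * c / rho)%:E)%E.
Proof.
move=> x0 halpha; rewrite /gain.
have T0 := ruin_time_ge0 c N Y x alpha w.
set T := ruin_time _ _ _ _ _ _.
set DK := discounted_total rho (injections alpha w) T.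
set DZ := discounted_total rho (dividends alpha w) T.
have DK0 : (0 <= DK)%E := discounted_total_ge0 _ _ _.
have delta0 : 0 < delta by rewrite (lt_trans _ hdelta).
have le_DZ : (DZ <= (x + 4 * c / rho)%:E + DK)%E.
  apply: discounted_total_le => //; first exact: ltW.
  - exact: (dividends_lt0 halpha).
  - exact: (injections_lt0 halpha).
  move=> s s0 sT; rewrite (right_lim_dividends halpha)//.
  exact: (dividends_le hc hN hY halpha).
move: DK DK0 le_DZ => [k| |]//.
  rewrite lee_fin => k0 le_DZ; rewrite leeBlDr// (le_trans le_DZ)// leeD2l//.
  by rewrite -EFinM lee_fin ler_peMl// ltW.
by rewrite gt0_muley ?lte_fin// addeNy leNye.
Qed.

Definition null_path : monotone_path R :=
  @MonotonePath R (fun=> 0) (fun _ _ _ => lexx 0).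

Definition null_strategy : @strategy R d Omega :=
  Strategy (fun=> null_path) (fun=> null_path).

Lemma null_strategy_admissible x : admissible Ft c N Y x null_strategy.
Proof.
have cvg0 (F : set_system R) (FF : Filter F) : null_path s @[s --> F] --> (0 : R).
  exact: cvg_cst.
have ad0 : adapted Ft (fun (w : Omega) t => null_path t).
  move=> t t0 B mB; have [/(_ _ t0)[[Ft0 FtC _] _] _ _ _] := hFt.
  have [B0|nB0] := pselect (B 0).
    rewrite (_ : [set w | _] = setT `\` set0); first exact: FtC.
    by rewrite setD0; apply/seteqP; split.
  by rewrite (_ : [set w | _] = set0)//; apply/seteqP; split.
split => // [w t t0|w t t0|w t t0].
- by split; [exact: cvg0|apply/cvg_ex; exists 0; exact: cvg0].
- by split; [exact: cvg0|apply/cvg_ex; exists 0; exact: cvg0].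
- by rewrite (cvg_lim _ (cvg0 _ _))// subrr le_max lexx.
Qed.

Lemma reward_null_strategy x : reward c rho delta N Y x null_strategy = 0%E.
Proof.
apply: integral0_eq => w _; have T0 := ruin_time_ge0 c N Y x null_strategy w.
by rewrite !discounted_total_null// mule0 sube0.
Qed.

(** * Paying a lump sum at time 0 *)

Lemma controlled_surplus_left_lim0 x alpha w :
    (forall s, s < 0 -> dividends alpha w s = 0) ->
    (forall s, s < 0 -> injections alpha w s = 0) ->
  lim (controlled_surplus c N Y x alpha w s @[s --> 0^'-]) = x.
Proof.
move=> Z0 K0; apply: left_lim_at0 => s s0; rewrite /controlled_surplus.
by rewrite (surplus_le0 _ _ hN) ?ltW// Z0// K0// subr0 addr0.
Qed.

Section LumpSum.
Variables (r : R) (r0 : 0 <= r).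

Definition add_lump (A : monotone_path R) (t : R) : R := A t + r * (0 <= t)%R%:R.

Lemma add_lump_nondecreasing A : {homo add_lump A : s t / s <= t}.
Proof.
move=> s t st; rewrite lerD ?path_nondecreasing// ler_wpM2l// ler_nat.
by case: (leP 0 s) => // s0; rewrite (le_trans s0 st).
Qed.

Definition lump_path A := MonotonePath (@add_lump_nondecreasing A).

Definition pay_lump alpha : strategy :=
  Strategy (fun w => lump_path (dividends alpha w)) (injections alpha).

Lemma lump_pathE A t : 0 <= t -> lump_path A t = A t + r.
Proof. by move=> t0; rewrite /lump_path/= /add_lump t0 mulr1. Qed.

Lemma lump_path_lt0 A t : t < 0 -> lump_path A t = A t.
Proof. by move=> t0; rewrite /lump_path/= /add_lump leNgt t0 mulr0 addr0. Qed.

Lemma controlled_surplus_pay_lump x alpha w t : 0 <= t ->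
  controlled_surplus c N Y (x + r) (pay_lump alpha) w t =
  controlled_surplus c N Y x alpha w t.
Proof.
move=> t0; rewrite /controlled_surplus [dividends _ _]/= lump_pathE//.
by rewrite (surplusD _ _ _ (x + r)) (surplusD _ _ _ x)/=; ring.
Qed.

Lemma ruin_time_pay_lump x alpha w :
  ruin_time c N Y (x + r) (pay_lump alpha) w = ruin_time c N Y x alpha w.
Proof.
rewrite /ruin_time; congr (ereal_inf _).
suff XE t : 0 <= t ->
    controlled_surplus c N Y (x + r) (pay_lump alpha) w s @[s --> t^'+] =
    controlled_surplus c N Y x alpha w s @[s --> t^'+].
  apply/seteqP; split => _ [t [t0 Xt] <-]; exists t => //; split => //.
    by rewrite -XE.
  by rewrite XE.
move=> t0; apply: near_eq_fmap; near=> s; apply: controlled_surplus_pay_lump.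
by apply: (le_trans t0); apply/ltW; near: s; exact: nbhs_right_gt.
Unshelve. all: by end_near. Qed.

(** For [t > 0] the jump condition is literally the one for [alpha].  At [t = 0]
it becomes [Z_0 + r <= x + r], which follows from [Z_0 <= max 0 x] as [0 <= x]. *)
Lemma pay_lump_admissible x alpha : 0 <= x ->
  admissible Ft c N Y x alpha -> admissible Ft c N Y (x + r) (pay_lump alpha).
Proof.
move=> x0 halpha; have [[adZ adK] AK0 hZ hK hjump] := halpha.
have Zright w t : 0 <= t ->
    lump_path (dividends alpha w) s @[s --> t^'+] =
    dividends alpha w s + r @[s --> t^'+].
  move=> t0; apply: near_eq_fmap; near=> s; apply: lump_pathE.
  by apply: (le_trans t0); apply/ltW; near: s; exact: nbhs_right_gt.
have Zleft w t : 0 < t ->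
    lump_path (dividends alpha w) s @[s --> t^'-] =
    dividends alpha w s + r @[s --> t^'-].
  move=> t0; apply: near_eq_fmap; near=> s; apply: lump_pathE.
  by apply/ltW; near: s; exact: nbhs_left_gt.
have Zleft0 w : lump_path (dividends alpha w) s @[s --> 0^'-] =
    dividends alpha w s @[s --> 0^'-].
  by apply: near_eq_fmap; near=> s; rewrite lump_path_lt0.
split.
- split => // t t0 B mB.
  rewrite (_ : [set w | _] =
    [set w | ((fun z => z + r) @^-1` B) (dividends alpha w t)]).
    apply: adZ => //; rewrite -[X in measurable X]setTI.
    by apply: measurable_funD mB => //.
  by apply/seteqP; split => w; rewrite /= /add_lump t0 mulr1.
- move=> w t t0; rewrite [dividends _ _]/= lump_path_lt0//; exact: AK0.
- move=> w t t0; have [Zr Zl] := hZ w t t0.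
  split; rewrite [dividends _ w]/=.
    by rewrite Zright// lump_pathE//; apply: cvgD => //; exact: cvg_cst.
  have [t_eq0|t_neq0] := eqVneq t 0; first by rewrite t_eq0 Zleft0 -t_eq0.
  rewrite Zleft ?lt_neqAle 1?eq_sym ?t_neq0//; apply: is_cvgD => //.
  exact: is_cvg_cst.
- exact: hK.
move=> w t t0; have [Zr Zl] := hZ w t t0.
have [t_eq0|t_neq0] := eqVneq t 0.
  rewrite t_eq0 in hjump *.
  have := hjump w 0 (lexx 0).
  rewrite controlled_surplus_left_lim0 => [|s s0|s s0]; last 2 first.
  - exact: (dividends_lt0 halpha).
  - exact: (injections_lt0 halpha).
  rewrite controlled_surplus_left_lim0 => [|s s0|s s0]; last 2 first.
  - by rewrite [dividends _ _]/= lump_path_lt0// (dividends_lt0 halpha).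
  - exact: (injections_lt0 halpha).
  rewrite (left_lim_at0 (v := 0)); last by move=> s; exact: (dividends_lt0 halpha).
  rewrite (left_lim_at0 (v := 0)); last first.
    by move=> s s0; rewrite (surplus_le0 _ _ hN)// ltW.
  rewrite (left_lim_at0 (v := 0)); last first.
    by move=> s s0; rewrite [dividends _ _]/= lump_path_lt0// (dividends_lt0 halpha).
  rewrite [dividends (pay_lump _) _]/= lump_pathE// (surplus_le0 _ _ hN)//.
  by rewrite !subr0 !addr0 !max_r ?lerD2r// addr_ge0.
have {}t_gt0 : 0 < t by rewrite lt_neqAle eq_sym t_neq0.
have := hjump w t t0.
rewrite [dividends (pay_lump _) _]/= lump_pathE// Zleft//.
have -> : controlled_surplus c N Y (x + r) (pay_lump alpha) w s @[s --> t^'-] =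
    controlled_surplus c N Y x alpha w s @[s --> t^'-].
  apply: near_eq_fmap; near=> s; apply: controlled_surplus_pay_lump.
  by apply/ltW; near: s; exact: nbhs_left_gt.
have -> : lim (dividends alpha w s + r @[s --> t^'-]) =
    lim (dividends alpha w s @[s --> t^'-]) + r.
  by apply/cvg_lim => //; apply: cvgD => //; exact: cvg_cst.
by rewrite opprD addrACA subrr addr0.
Unshelve. all: by end_near. Qed.

Lemma gain_pay_lump x alpha w : admissible Ft c N Y x alpha ->
  gain (x + r) (pay_lump alpha) w = (gain x alpha w + r%:E)%E.
Proof.
move=> halpha; rewrite /gain ruin_time_pay_lump [dividends _ _]/=.
rewrite (discounted_total_shift (A := dividends alpha w) (r := r))//.
- by rewrite addeAC.
- exact: ruin_time_ge0.
- exact: (dividends_lt0 halpha).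
- by move=> s s0; rewrite lump_path_lt0// (dividends_lt0 halpha).
move=> s s0; rewrite (right_lim_dividends halpha)// -lump_pathE//.
apply: right_lim_id; have [_ _ /(_ w _ s0)[Zs _] _ _] := halpha.
rewrite lump_pathE//.
rewrite (_ : _ @ _ = dividends alpha w u + r @[u --> s^'+]).
  by apply: cvgD => //; exact: cvg_cst.
apply: near_eq_fmap; near=> u; apply: lump_pathE.
by apply: (le_trans s0); apply/ltW; near: u; exact: nbhs_right_gt.
Unshelve. all: by end_near. Qed.

End LumpSum.

(** * The value function *)

Let reward_le x alpha : 0 <= x -> admissible Ft c N Y x alpha ->
  (reward c rho delta N Y x alpha <= (x + 4 * c / rho)%:E)%E.
Proof.
move=> x0 halpha; rewrite rewardE.
apply: (integral_bounded_above P (measurable_gain halpha)) => [|w]; last exact: gain_le.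
by rewrite addr_ge0// divr_ge0 ?mulr_ge0// ltW.
Qed.

Let value_fin_num x : 0 <= x -> value_function Ft c rho delta N Y x \is a fin_num.
Proof.
move=> x0; apply/fin_numP; split.
  rewrite -ltNye (@lt_le_trans _ _ 0%E)// -(reward_null_strategy x).
  by apply: ereal_sup_ubound; exists null_strategy => //; exact: null_strategy_admissible.
rewrite -ltey (@le_lt_trans _ _ (x + 4 * c / rho)%:E) ?ltry//.
by apply: ge_ereal_sup => _ [alpha halpha <-]; exact: reward_le.
Qed.

Lemma value_function_increment x x' : 0 <= x -> x < x' ->
  ((x' - x)%:E <= value_function Ft c rho delta N Y x'
                  - value_function Ft c rho delta N Y x)%E.
Proof.
move=> x0 xx'; have r0 : 0 <= x' - x by rewrite subr_ge0 ltW.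
have xx'E : x + (x' - x) = x' by rewrite subrKC.
have vx := value_fin_num x0.
rewrite leeBrDr// addeC -leeBrDr//.
apply: ge_ereal_sup => _ [alpha halpha <-]; rewrite leeBrDr//.
apply: (@le_trans _ _ (reward c rho delta N Y x' (pay_lump r0 alpha))).
  rewrite !rewardE.
  have C0 : 0 <= x + 4 * c / rho by rewrite addr_ge0// divr_ge0 ?mulr_ge0// ltW.
  have gC w : (gain x alpha w <= (x + 4 * c / rho)%:E)%E by exact: gain_le.
  apply: (le_trans (integral_add_cst P (measurable_gain halpha) C0 gC (x' - x))).
  by under eq_integral do rewrite -(gain_pay_lump r0 _ halpha) xx'E.
apply: ereal_sup_ubound; exists (pay_lump r0 alpha) => //.
by have := pay_lump_admissible r0 x0 halpha; rewrite xx'E.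
Qed.

End Reward.

Theorem mainTheorem2 (R : realType) (d : measure_display)
  (Omega : measurableType d) (P : probability Omega R)
  (Ft : R -> set (set Omega)) (c a b eta rho delta : R)
  (f : R -> R) (Y : nat -> {RV P >-> R})
  (y : R) (N : Omega -> R -> nat) (lambda : Omega -> R -> R)
  (hFt : usual_filtration P Ft)
  (hc : 0 < c) (ha : 0 < a) (hb : 0 < b) (heta : 0 < eta) (hrho : 0 < rho)
  (hdelta : 1 < delta)
  (hYpos : forall k w, 0 < Y k w)
  (hYdensity : forall k, has_density (Y k) f)
  (hYindep : mutually_independent Y)
  (hy : b <= y)
  (hN : hawkes_process P Ft a b eta y N lambda)
  (hYN : independent_sigma_algebras P
           (generated_sigma_algebra (fun k w => Y k w))
           (generated_sigma_algebra (fun t w => N w t)))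
  (x x' : R) (hx : 0 <= x) (hxx' : x < x') :
  ((x' - x)%:E <= value_function Ft c rho delta N Y x'
                  - value_function Ft c rho delta N Y x)%E.
Proof.
have [hcount hadapted _ _ _] := hN.
exact: value_function_increment.
Qed.
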